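(* Let $\mathcal{H}$ be a complex Hilbert space and let $q\in\mathcal{B}(\mathcal{H})$ be a (not necessarily Hermitian) rank-one projection, i.e. $q^2=q$ and $\mathrm{Tr}(q)=1$. Then $$\sqrt{q^*q}=\frac{q^*q}{\sqrt{\mathrm{Tr}(q^*q)}},$$ and consequently the trace-class norm and the Hilbert–Schmidt norm of $q$ agree: $\mathrm{Tr}\big(\sqrt{q^*q}\big)=\sqrt{\mathrm{Tr}(q^*q)}$.
   Context: $\mathcal{B}(\mathcal{H})$ denotes the bounded linear operators on $\mathcal{H}$, and $\sqrt{q^*q}$ is the positive square root of the nonnegative operator $q^*q$. *)

(* Defs.v *)
From HB Require Import structures.
From mathcomp Require Import all_boot all_order all_algebra finmap complex.
From mathcomp Require Import all_classical all_reals all_analysis.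
From mathcomp.analysis.showcase Require summability.

Set Implicit Arguments.
Unset Strict Implicit.
Unset Printing Implicit Defensive.
Import Order.TTheory GRing.Theory Num.Theory.
Import numFieldNormedType.Exports.

Local Open Scope classical_set_scope.
Local Open Scope ring_scope.
Local Open Scope complex_scope.

(* The inner product is linear in its first argument and conjugate-linear in
   the second one. *)
HB.mixin Record CompleteNormedModule_isHilbert (R : realType) H
    of CompleteNormedModule R[i] H := {
  hdot : {dot H for @Num.conj R[i]} ;
  hdot_norm : forall x : H, hdot x x = `|x| ^+ 2
}.

#[short(type="hilbertType")]
HB.structure Definition Hilbert (R : realType) :=
  {H of CompleteNormedModule R[i] H & CompleteNormedModule_isHilbert R H}.

Section Operators.
Context {R : realType} {H : hilbertType R}.
Implicit Types (S T : H -> H) (E : set H).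

Definition bounded_operator T : Prop :=
  linear T /\ exists M : R, forall x : H, `|T x| <= M%:C * `|x|.

(* The order of R[i] makes [0 <= z] say that z is real and nonnegative. *)
Definition nonneg_operator T : Prop := forall x : H, 0 <= hdot (T x) x.

(* [adjoint] and [op_sqrt] pick the unique operator with the stated property;
   the default 0 is never taken when T is bounded (and, for [op_sqrt],
   nonnegative). *)
Definition adjoint T : H -> H :=
  xget 0 [set S | bounded_operator S /\
                  forall x y : H, hdot (T x) y = hdot x (S y)].

Definition op_sqrt T : H -> H :=
  xget 0 [set S | [/\ bounded_operator S, nonneg_operator S & S \o S = T]].

Definition op_abs T : H -> H := op_sqrt (adjoint T \o T).

(* A maximal orthonormal set; it need not be countable. *)
Definition orthonormal_basis E : Prop :=
  (forall x y : H, E x -> E y -> hdot x y = (x == y)%:R) /\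
  (forall x : H, (forall e : H, E e -> hdot x e = 0) -> x = 0).

Definition trace_class T : Prop :=
  bounded_operator T /\
  forall E, orthonormal_basis E ->
    (\esum_(e in E) (complex.Re (hdot (op_abs T e) e))%:E < +oo)%E.

(* [t] is the sum of <T e, e> over E, in the sense of the limit of the sums
   over finite subsets of E. *)
Definition diag_sum_cvg T E (t : R[i]) : Prop :=
  summability.partial_sum
    (fun e : E => hdot (T (\val e)) (\val e) : R[i]^o)
    @ summability.totally --> (t : R[i]^o).

(* The trace of a trace-class operator is the value shared by the sums of
   <T e, e> over all orthonormal bases. Operators that are not trace class get
   0, so [Tr T = 1] entails that T is trace class. *)
Definition Tr T : R[i] :=
  xget 0 [set t | trace_class T /\
                  forall E, orthonormal_basis E -> diag_sum_cvg T E t].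

End Operators.

(* Main.v *)
Require Import Defs.
From mathcomp Require Import all_boot all_order all_algebra finmap complex.
From mathcomp Require Import all_classical all_reals all_analysis.
From mathcomp.analysis.showcase Require summability.
From mathcomp Require Import ring.
Import Order.TTheory GRing.Theory Num.Theory.
Import numFieldNormedType.Exports.
Local Open Scope ring_scope.


(** Evaluate the trace of [q] in an orthonormal basis adapted to the range of
    [q]: a vector of the range contributes 1 and a vector orthogonal to the
    range contributes 0, so [Tr q = 1] forces the range to be spanned by one
    unit vector [a]. By Riesz, [q x = <x, b> a] for some [b], hence
    [q^* q = <., b> b]. Its only nonnegative square root is [<., b> b / |b|],
    and Parseval's identity gives [Tr (<., b> b) = |b|^2]. *)

(** * Inner product identities and the Cauchy-Schwarz inequality *)

Section InnerProduct.
Context {R : realType} {H : hilbertType R}.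
Implicit Types (x y z : H) (a : R[i]).

Lemma hdotDl z x y : hdot (x + y) z = hdot x z + hdot y z.
Proof. by rewrite linearDl. Qed.

Lemma hdotDr z x y : hdot z (x + y) = hdot z x + hdot z y.
Proof. by rewrite linearDr. Qed.

Lemma hdotBl z x y : hdot (x - y) z = hdot x z - hdot y z.
Proof. by rewrite linearBl. Qed.

Lemma hdotBr z x y : hdot z (x - y) = hdot z x - hdot z y.
Proof. by rewrite linearBr. Qed.

Lemma hdotZl z a x : hdot (a *: x) z = a * hdot x z.
Proof. by rewrite linearZl_LR. Qed.

Lemma hdotZr z a x : hdot z (a *: x) = a^* * hdot z x.
Proof. by rewrite linearZr_LR. Qed.

Lemma hdot_suml (I : Type) (r : seq I) (F : I -> H) z :
  hdot (\sum_(i <- r) F i) z = \sum_(i <- r) hdot (F i) z.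
Proof. exact: (linear_sumlz hdot). Qed.

Lemma hdot_sumr (I : Type) (r : seq I) (F : I -> H) z :
  hdot z (\sum_(i <- r) F i) = \sum_(i <- r) hdot z (F i).
Proof. exact: (linear_sumr hdot). Qed.

Lemma hdot0l x : hdot 0 x = 0.
Proof. by rewrite linear0l. Qed.

Lemma hdot0r x : hdot x 0 = 0.
Proof. by rewrite linear0r. Qed.

Lemma hdotC x y : hdot x y = (hdot y x)^*.
Proof. by rewrite hermC expr0 mul1r. Qed.

Lemma hdot_eq0C x y : hdot x y = 0 -> hdot y x = 0.
Proof. by rewrite (hdotC y) => ->; rewrite conjC0. Qed.

Lemma hdot_eq0 x : hdot x x = 0 -> x = 0.
Proof. by move/eqP; rewrite hdot_norm sqrf_eq0 normr_eq0 => /eqP. Qed.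

Lemma hdotM_conj x y : hdot x y * hdot y x = `|hdot x y| ^+ 2.
Proof. by rewrite normCK (hdotC y). Qed.

(** The residual is orthogonal to [y], so its squared norm is its inner product with [x]. *)
Lemma sqr_norm_sub_proj x y : y != 0 ->
  `|x - (hdot x y / `|y| ^+ 2) *: y| ^+ 2
    = `|x| ^+ 2 - `|hdot x y| ^+ 2 / `|y| ^+ 2.
Proof.
move=> y0; have n0 : `|y| ^+ 2 != 0 by rewrite sqrf_eq0 normr_eq0.
rewrite -hdot_norm hdotBr hdotZr [X in _ - _ * X]hdotBl hdotZl hdot_norm.
rewrite divfK // subrr mulr0 subr0 hdotBl hdotZl hdot_norm -hdotM_conj.
by rewrite mulrAC.
Qed.

Lemma cauchy_schwarz x y : `|hdot x y| <= `|x| * `|y|.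
Proof.
have [->|y0] := eqVneq y 0; first by rewrite hdot0r !normr0 mulr0.
have n0 : 0 < `|y| ^+ 2 by rewrite exprn_gt0 // normr_gt0.
have := exprn_ge0 2 (normr_ge0 (x - (hdot x y / `|y| ^+ 2) *: y)).
rewrite sqr_norm_sub_proj // subr_ge0 ler_pdivrMr // -exprMn.
by rewrite ler_pXn2r // nnegrE ?mulr_ge0.
Qed.

Lemma parallelogram x y :
  `|x + y| ^+ 2 + `|x - y| ^+ 2 = 2 * `|x| ^+ 2 + 2 * `|y| ^+ 2.
Proof. by rewrite -!hdot_norm !(hdotBl, hdotBr, hdotDl, hdotDr); ring. Qed.

End InnerProduct.

(** * Orthogonal projection onto the closure of a subspace *)

Section Projection.
Context {R : realType} {H : hilbertType R}.
Implicit Types (x y z : H) (V : set H).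
Local Open Scope classical_set_scope.

Lemma posC_real (e : R[i]) : 0 < e -> exists2 r : R, 0 < r & e = r%:C%C.
Proof.
move=> e0; exists (complex.Re e).
  by move: e0; rewrite ltcE => /andP[].
by rewrite RRe_real // gtr0_real.
Qed.

Lemma closure_norm V p : closure V p ->
  forall e : R[i], 0 < e -> exists2 v, V v & `|p - v| < e.
Proof.
move=> Vp e e0; have /= := Vp _ (nbhsx_ballx p e e0).
by rewrite -ball_normE => -[v [Vv /= pv]]; exists v.
Qed.

(** Replaces a continuity argument when showing that the kernel of a bounded functional or the fixed
    space of a bounded operator is closed. *)
Lemma closure_bound_le0 V p (g : R[i]) (M : R) : closure V p ->
  (forall v, V v -> g <= M%:C%C * `|p - v|) -> g <= 0.
Proof.
move=> Vp gM; apply/ler_addgt0Pr => e e0; rewrite add0r.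
have M1 : 0 < (`|M| + 1)%:C%C :> R[i] by rewrite ltcR ltr_wpDl.
have [v Vv pv] := closure_norm _ _ Vp _ (divr_gt0 e0 M1).
apply: (le_trans (gM _ Vv)).
apply: (@le_trans _ _ ((`|M| + 1)%:C%C * `|p - v|)).
  by rewrite ler_wpM2r // lecR (le_trans (ler_norm M)) // lerDl.
by rewrite mulrC -ler_pdivlMr // ltW.
Qed.

(** Closedness is not included: the subspace used in [diag_sum_rank_one] is in general not
    closed. *)
Definition linear_subspace V :=
  V 0 /\ forall (a : R[i]) u v, V u -> V v -> V (a *: u + v).

Lemma subspaceZ V a v : linear_subspace V -> V v -> V (a *: v).
Proof. by move=> [V0 VP] Vv; rewrite -[_ *: _]addr0; apply: VP. Qed.

(* Elements of [V] almost minimizing [|x - v|] form a Cauchy filter by the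
   parallelogram law, and are almost orthogonal to [V] after subtraction
   from [x]. *)
Lemma orthogonal_decomposition V x : linear_subspace V ->
  exists2 p, closure V p & forall v, V v -> hdot (x - p) v = 0.
Proof.
move=> sV; have [V0 VP] := sV.
(* [inf] is taken in [R], while norms have values in [R[i]]; hence the real parts. *)
pose D : set R := [set complex.Re (`|x - v| ^+ 2) | v in V].
have ReE v : (complex.Re (`|x - v| ^+ 2))%:C%C = `|x - v| ^+ 2.
  by rewrite RRe_real // realX // normr_real.
have D0 : D !=set0 by exists (complex.Re (`|x - 0| ^+ 2)), 0.
have Dlb : lbound D 0.
  by move=> _ [v Vv <-]; rewrite -lecR ReE exprn_ge0.
have hD : has_inf D by split=> //; exists 0.
have dle v : V v -> (inf D)%:C%C <= `|x - v| ^+ 2.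
  move=> Vv; rewrite -ReE lecR; apply: ge_inf; first by exists 0.
  by exists v.
pose B (e : R[i]) := [set v | V v /\ `|x - v| ^+ 2 < (inf D)%:C%C + e].
have B0 e : 0 < e -> B e !=set0.
  move=> /posC_real[r r0 ->]; have [_ [v Vv <-] vr] := inf_adherent r0 hD.
  by exists v; split=> //; rewrite -ReE -rmorphD /= ltcR.
pose F := filter_from [set e : R[i] | 0 < e] B.
have FF : ProperFilter F.
  apply: filter_from_proper => //; apply: filter_from_filter; first by exists 1 => /=.
  move=> _ _ /= /posC_real[e e0 ->] /posC_real[f f0 ->].
  exists (Num.min e f)%:C%C; first by rewrite ltcR lt_min e0.
  move=> v [Vv xv]; split; split=> //; apply: (lt_le_trans xv);
    by rewrite lerD2l lecR ge_min lexx ?orbT.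
have cF : cauchy F.
  apply: cauchy_exP => eps eps0.
  (* The parallelogram law bounds the squared distance between two members of [B e] by [4 * e],
     which is [eps ^+ 2] for this choice of [e]. *)
  have d0 : 0 < (eps / 2) ^+ 2 by rewrite exprn_gt0 // divr_gt0.
  have [v [Vv xv]] := B0 _ d0.
  exists v, ((eps / 2) ^+ 2) => //= w [Vw xw].
  rewrite -ball_normE /= distrC -(ltr_pXn2r (n := 2)) // ?nnegrE ?normr_ge0 ?ltW //.
  (* The midpoint stays in [V], so its squared distance to [x] is at least [inf D]. *)
  have Vm : V (2^-1 *: (v + w)).
    by apply: subspaceZ => //; rewrite -[v]scale1r; apply: VP.
  have := dle _ Vm; have := parallelogram (x - v) (x - w).
  have -> : x - v + (x - w) = 2 *: (x - 2^-1 *: (v + w)).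
    rewrite scalerBr scalerA divff ?pnatr_eq0 // scale1r scaler_nat mulr2n.
    by rewrite opprD addrACA.
  have -> : x - v - (x - w) = w - v by rewrite opprB addrC addrA subrK.
  rewrite normrZ exprMn ger0_norm // => par dm.
  have := ltrD xv xw.
  have -> : eps ^+ 2 = 4 * (eps / 2) ^+ 2 by field.
  move: par dm; set X := `|x - v| ^+ 2; set Y := `|x - w| ^+ 2.
  set M := `|x - 2^-1 *: _| ^+ 2; set W := `|w - v| ^+ 2.
  set d := (inf D)%:C%C; set e := (eps / 2) ^+ 2 => par dm xy.
  have -> : W = 2 * (X + Y) - 4 * M by rewrite mulrDr -par; ring.
  apply: (@le_lt_trans _ _ (2 * (X + Y) - 4 * d)).
    by rewrite lerB // ler_pM2l.
  apply: (@lt_le_trans _ _ (2 * (d + e + (d + e)) - 4 * d)).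
    by rewrite ltrD2r ltr_pM2l.
  by rewrite le_eqVlt; apply/orP; left; apply/eqP; ring.
have cvF : F --> lim F by exact: (cauchy_cvg F cF).
have near_lim e : 0 < e -> exists2 w, B (e ^+ 2) w & `|lim F - w| < e.
  move=> e0; have e20 : 0 < e ^+ 2 by rewrite exprn_gt0.
  have FB : F (B (e ^+ 2)) by exists (e ^+ 2).
  have Fb : F (ball (lim F) e) by apply: cvF; exact: nbhsx_ballx.
  have [w [Bw]] := filter_ex (filterI FB Fb).
  by rewrite -ball_normE /= => bw; exists w.
exists (lim F).
  move=> U /cvF FU; have FB : F (B 1) by exists 1 => /=.
  by have [w [[Vw _] Uw]] := filter_ex (filterI FB FU); exists w.
move=> v Vv; have [->|v0] := eqVneq v 0; first by rewrite hdot0r.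
have nv0 : 0 < `|v| by rewrite normr_gt0.
apply/eqP; rewrite -normr_le0; apply/ler_addgt0Pr => eps eps0; rewrite add0r.
(* One half of [eps] pays for replacing [lim F] by [w], the other half for the failure of [x - w] to
   be orthogonal to [v]. *)
have := @near_lim (eps / (2 * `|v|)); case.
  by rewrite divr_gt0 // mulr_gt0.
move=> w [Vw xw] pw; set e := eps / (2 * `|v|) in xw pw.
have e0 : 0 < e by rewrite divr_gt0 // mulr_gt0.
have -> : eps = e * `|v| + e * `|v| by rewrite /e; field; rewrite gt_eqF.
rewrite -[x - _](subrKA w) hdotDl (le_trans (ler_normD _ _)) // lerD //; last first.
  rewrite (le_trans (cauchy_schwarz _ _)) // ler_wpM2r // distrC ltW //.
have ev0 : 0 <= e * `|v| by rewrite mulr_ge0 // ltW.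
rewrite -(ler_pXn2r (n := 2)) ?nnegrE // exprMn.
rewrite -ler_pdivrMr ?exprn_gt0 //.
(* Moving [w] along [v] by the projection coefficient lowers the squared distance to [x] as in
   [sqr_norm_sub_proj]; since [w] is within [e ^+ 2] of the infimum, the drop is at most
   [e ^+ 2]. *)
have Vu : V ((hdot (x - w) v / `|v| ^+ 2) *: v + w) by apply: VP.
have := dle _ Vu; rewrite opprD addrA addrAC sqr_norm_sub_proj //.
by rewrite lerBrDr -lerBrDl => /le_trans; apply; rewrite lerBlDl ltW.
Qed.

End Projection.

(** * Orthonormal sets and bases *)

Section Orthonormal.
Context {R : realType} {H : hilbertType R}.
Implicit Types (x y z : H) (V E : set H).
Local Open Scope classical_set_scope.

Definition orthonormal_set E :=
  forall x y, E x -> E y -> hdot x y = (x == y)%:R.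

Lemma orthonormal_setU1 E u : orthonormal_set E -> hdot u u = 1 ->
  (forall e, E e -> hdot u e = 0) -> orthonormal_set (E `|` [set u]).
Proof.
move=> oE u1 uE; have neq e : E e -> (u == e) = false.
  move=> /uE ue; apply/eqP => ue1; move: ue; rewrite -ue1 u1.
  by move/eqP; rewrite oner_eq0.
move=> x y [Ex|->] [Ey|->]; first exact: oE.
- by rewrite eq_sym neq // (hdot_eq0C _ _ (uE _ Ex)).
- by rewrite neq // uE.
- by rewrite eqxx.
Qed.

(** Zorn's lemma: a nonzero vector of [V] orthogonal to a maximal [E] could be normalized and added
    to [E]. *)
Lemma exists_maximal_orthonormal_set V : linear_subspace V ->
  exists E, [/\ E `<=` V, orthonormal_set E &
    forall x, V x -> (forall e, E e -> hdot x e = 0) -> x = 0].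
Proof.
move=> sV; pose P E := E `<=` V /\ orthonormal_set E.
have [F FP totF|E [[EV oE] Emax]] := @Zorn_bigcup H P.
  split=> [x [X /FP[XV _]]|x y [X FX Xx] [Y FY Yy]]; first exact: XV.
  have [XY|YX] := totF _ _ FX FY.
    by have [_ oY] := FP _ FY; apply: oY => //; apply: XY.
  by have [_ oX] := FP _ FX; apply: oX => //; apply: YX.
exists E; split=> // x Vx xE; apply: contrapT => /eqP x0.
have nx0 : `|x| != 0 by rewrite normr_eq0.
pose u := `|x|^-1 *: x.
have uu : hdot u u = 1.
  rewrite hdotZl hdotZr hdot_norm geC0_conj ?invr_ge0 // expr2.
  by rewrite mulKf // mulVf.
have uE e : E e -> hdot u e = 0 by move=> Ee; rewrite hdotZl xE // mulr0.
apply: (Emax (E `|` [set u])); last first.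
  split; last exact: orthonormal_setU1.
  by move=> y [Ey|->]; [exact: EV|exact: subspaceZ].
split; first by move=> y; left.
move=> /(_ u (or_intror erefl)) /uE; rewrite uu.
by move/eqP; rewrite oner_eq0.
Qed.

Definition orthogonal_complement V : set H :=
  [set x | forall v, V v -> hdot x v = 0].

Lemma linear_subspace_orthogonal_complement V : linear_subspace (orthogonal_complement V).
Proof.
split=> [v _|a x y xV yV v Vv]; first by rewrite hdot0l.
by rewrite hdotDl hdotZl xV // yV // mulr0 addr0.
Qed.

(** Take maximal orthonormal sets in [V] and in its complement. A vector orthogonal to both has zero
    component in the complement, hence lies in [V] and vanishes by maximality there. *)
Lemma exists_adapted_orthonormal_basis V : linear_subspace V -> closure V `<=` V ->
  exists E1 E2, [/\ E1 `<=` V, E2 `<=` orthogonal_complement V,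
    orthonormal_basis (E1 `|` E2) &
    forall x, V x -> (forall e, E1 e -> hdot x e = 0) -> x = 0].
Proof.
move=> sV cV; have [E1 [E1V oE1 maxE1]] := exists_maximal_orthonormal_set V sV.
have [E2 [E2V oE2 maxE2]] :=
  exists_maximal_orthonormal_set _ (linear_subspace_orthogonal_complement V).
have o21 x y : E2 x -> E1 y -> hdot x y = 0.
  by move=> /E2V xV /E1V yV; apply: xV.
have n21 x y : E2 x -> E1 y -> (x == y) = false.
  move=> Ex Ey; apply/eqP => xy; have := o21 _ _ Ex Ey.
  rewrite xy oE1 // eqxx => /eqP; by rewrite oner_eq0.
exists E1, E2; split=> //; split.
  move=> x y [E1x|E2x] [E1y|E2y]; [exact: oE1| | |exact: oE2].
    by rewrite eq_sym n21 // (hdot_eq0C _ _ (o21 _ _ E2y E1x)).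
  by rewrite n21 // o21.
move=> x xE; have [p /cV Vp xp] := orthogonal_decomposition V x sV.
have px : x - p = 0.
  apply: maxE2 => // e E2e.
  by rewrite hdotBl xE; [rewrite (hdot_eq0C _ _ (E2V _ E2e _ Vp)) subr0|right].
move/subr0_eq: px xE => -> pE; apply: maxE1 => // e E1e.
by apply: pE; left.
Qed.

Lemma exists_orthonormal_basis : exists E : set H, orthonormal_basis E.
Proof.
have [||E1 [E2 [_ _ b _]]] := @exists_adapted_orthonormal_basis setT; first by [].
  by [].
by exists (E1 `|` E2).
Qed.

End Orthonormal.

(** * Riesz representation, adjoints and symmetric operators *)

Section Adjoint.
Context {R : realType} {H : hilbertType R}.
Implicit Types (x y z : H) (T S : H -> H).
Local Open Scope classical_set_scope.

(** For nonzero [f], take [z] orthogonal to the kernel with [f z] nonzero. Then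
    [x - (f x / f z) *: z] lies in the kernel, and pairing it with [z] gives the formula. *)
Lemma riesz (f : H -> R[i]) (M : R) :
  (forall a x y, f (a *: x + y) = a * f x + f y) ->
  (forall x, `|f x| <= M%:C%C * `|x|) ->
  exists b, forall x, f x = hdot x b.
Proof.
move=> fP fM.
have f0 : f 0 = 0.
  by apply/eqP; rewrite -normr_le0 (le_trans (fM _)) // normr0 mulr0.
have fB x y : f (x - y) = f x - f y.
  by rewrite addrC -scaleN1r fP mulN1r addrC.
have fZ a x : f (a *: x) = a * f x by rewrite -[_ *: _]addr0 fP f0 addr0.
have [f_eq0|/existsNP[x0 fx0]] := pselect (forall x, f x = 0).
  by exists 0 => x; rewrite hdot0r.
pose V := [set x | f x = 0].
have sV : linear_subspace V.
  by split=> [//|a u v Vu Vv]; rewrite /V /= fP Vu Vv mulr0 addr0.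
have [p Vp zV] := orthogonal_decomposition V x0 sV.
have fp : f p = 0.
  apply/eqP; rewrite -normr_le0; apply: (closure_bound_le0 _ _ _ M Vp) => v Vv.
  by rewrite -[f p]subr0 -Vv -fB.
set z := x0 - p in zV; have fz : f z != 0 by rewrite fB fp subr0; apply/eqP.
have z0 : hdot z z != 0.
  by apply/eqP => /hdot_eq0 z0; move: fz; rewrite z0 f0 eqxx.
exists ((f z / hdot z z)^* *: z) => x; rewrite hdotZr conjCK.
have Vx : V (x - (f x / f z) *: z) by rewrite /V /= fB fZ divfK // subrr.
have := hdot_eq0C _ _ (zV _ Vx); rewrite hdotBl hdotZl => /subr0_eq ->.
by field; rewrite fz z0.
Qed.

Lemma adjoint_eq T S : bounded_operator S ->
  (forall x y, hdot (T x) y = hdot x (S y)) -> adjoint T = S.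
Proof.
move=> bS TS; rewrite /adjoint; apply: xget_unique => // S' [_ TS'].
apply/funext => y; apply/subr0_eq/hdot_eq0.
by rewrite hdotBr -TS -TS' subrr.
Qed.

Lemma bounded_operatorD T : bounded_operator T -> {morph T : x y / x + y}.
Proof. by move=> [lT _] x y; have := lT 1 x y; rewrite !scale1r. Qed.

Lemma bounded_operatorZ T : bounded_operator T -> scalable T.
Proof.
move=> bT a x; have T0 : T 0 = 0.
  by apply: (addrI (T 0)); rewrite -(bounded_operatorD T bT) !addr0.
by have := bT.1 a x 0; rewrite T0 !addr0.
Qed.

(* A form with real diagonal values is hermitian, by polarization. *)
Lemma nonneg_operator_symmetric T : bounded_operator T -> nonneg_operator T ->
  forall x y, hdot (T x) y = hdot x (T y).
Proof.
move=> bT T0 x y; rewrite [RHS]hdotC.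
have real z : (hdot (T z) z)^* = hdot (T z) z by rewrite geC0_conj.
have TD := bounded_operatorD T bT; have TZ := bounded_operatorZ T bT.
have := real (x + y); have := real (x + 'i *: y).
rewrite !TD !TZ !(hdotDl, hdotDr, hdotZl, hdotZr) !rmorphD !rmorphM /=.
rewrite !conjCK conjCi !real.
set A := hdot (T x) y; set B := hdot (T y) x.
set X := hdot (T x) x; set Y := hdot (T y) y.
move=> /eqP; rewrite -subr_eq0 => /eqP e1 /eqP; rewrite -subr_eq0 => /eqP e2.
(* [e3] comes from [x + y] and [e4] from [x + 'i *: y]; their difference is [2 * B^* = 2 * A]. *)
have e3 : A^* + B^* - (A + B) = 0 by rewrite -[RHS]e2; ring.
have e4 : 'i * (A^* - B^* - (B - A)) = 0 by rewrite -[RHS]e1; ring.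
move/eqP: e4; rewrite mulf_eq0 (negPf (neq0Ci _)) /= => /eqP e4.
apply: subr0_eq; apply: (mulfI (_ : 2 != 0)); rewrite ?pnatr_eq0 // mulr0.
by rewrite -(subrr 0) -{1}e4 -e3; ring.
Qed.

End Adjoint.

(** * The operators [<., b> b]: square root and absolute value *)

Section RankOne.
Context {R : realType} {H : hilbertType R}.
Implicit Types (x y z b : H) (T S : H -> H).

(** This is the squared norm of [b] times the orthogonal projection onto the line of [b]. *)
Definition rank_one b : H -> H := fun x => hdot x b *: b.

Lemma hnorm_real_ex x : exists2 r : R, 0 <= r & `|x| = r%:C%C.
Proof.
exists (complex.Re `|x|); last by rewrite RRe_real // normr_real.
by rewrite -lecR RRe_real // normr_ge0.
Qed.

Lemma bounded_rank_one b : bounded_operator (rank_one b).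
Proof.
split=> [a x y|]; first by rewrite /rank_one hdotDl hdotZl scalerDl scalerA.
have [r r0 br] := hnorm_real_ex b; exists (r ^+ 2) => x.
rewrite normrZ rmorphXn /= -br expr2 mulrC -mulrA ler_wpM2l //.
by rewrite mulrC cauchy_schwarz.
Qed.

Lemma nonneg_rank_one b : nonneg_operator (rank_one b).
Proof. by move=> x; rewrite hdotZl hdotM_conj exprn_ge0. Qed.

Lemma adjoint_rank_one b : adjoint (rank_one b) = rank_one b.
Proof.
apply: adjoint_eq; first exact: bounded_rank_one.
by move=> x y; rewrite hdotZl hdotZr -hdotC mulrC.
Qed.

(** Absorbs a nonnegative factor into the vector, so that facts about [rank_one] extend to its
    nonnegative multiples. *)
Lemma scale_rank_one (c : R[i]) b : 0 <= c ->
  c *: rank_one b = rank_one (sqrtC c *: b).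
Proof.
move=> c0; apply/funext => x; rewrite /rank_one hdotZr scalerA.
have -> : (sqrtC c)^* = sqrtC c by rewrite geC0_conj // sqrtC_ge0.
rewrite -[LHS]/(c *: (hdot x b *: b)) scalerA.
by rewrite mulrAC -expr2 sqrtCK mulrC.
Qed.

Lemma rank_one_comp b : rank_one b \o rank_one b = `|b| ^+ 2 *: rank_one b.
Proof.
apply/funext => x; rewrite /rank_one /= hdotZl hdot_norm.
by rewrite -[RHS]/(`|b| ^+ 2 *: (hdot x b *: b)) scalerA mulrC.
Qed.

(* Any nonnegative square root commutes with [rank_one b], so [b] is one of
   its eigenvectors; being symmetric, it vanishes on the orthogonal of [b]. *)
Lemma op_sqrt_rank_one b : b != 0 ->
  op_sqrt (rank_one b) = `|b|^-1 *: rank_one b.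
Proof.
move=> b0; have nb : 0 < `|b| by rewrite normr_gt0.
have nb0 : `|b| != 0 by rewrite gt_eqF.
apply: xget_unique.
  split.
  - by rewrite scale_rank_one ?invr_ge0 //; apply: bounded_rank_one.
  - by rewrite scale_rank_one ?invr_ge0 //; apply: nonneg_rank_one.
  - rewrite scale_rank_one ?invr_ge0 // rank_one_comp -scale_rank_one ?invr_ge0 //.
    rewrite scalerA normrZ exprMn ger0_norm ?sqrtC_ge0 ?invr_ge0 //.
    by rewrite sqrtCK expr2 mulKf // divff // scale1r.
move=> S [bS nS SS]; have sS := nonneg_operator_symmetric S bS nS.
have SZ := bounded_operatorZ S bS; have SD := bounded_operatorD S bS.
have SSx x : S (S x) = hdot x b *: b by rewrite -[LHS]/((S \o S) x) SS.
(* By symmetry, the squared norm of [S x] is [hdot (S (S x)) x]. *)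
have S0 x : hdot x b = 0 -> S x = 0.
  by move=> xb; apply: hdot_eq0; rewrite -sS SSx hdotZl xb mul0r.
pose c := hdot (S b) b / `|b| ^+ 2.
(* [S (S (S b))] is computed twice: as [S \o S] applied to [S b], and as [S] applied to
   [hdot b b *: b]. *)
have Sb : S b = c *: b.
  have : S (S (S b)) = S (hdot b b *: b) by congr S; apply: SSx.
  rewrite SSx SZ hdot_norm => /(congr1 (fun v => (`|b| ^+ 2)^-1 *: v)).
  by rewrite /= !scalerA (mulVf (expf_neq0 2 nb0)) scale1r mulrC => <-.
have c0 : 0 <= c by rewrite divr_ge0 ?exprn_ge0 //; apply: nS.
have cb : c = `|b|.
  have /(congr1 (fun v => hdot v b)) : c *: (c *: b) = `|b| ^+ 2 *: b.
    by rewrite -Sb -SZ -Sb SSx hdot_norm.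
  rewrite !hdotZl mulrA -expr2 hdot_norm => /(mulIf (expf_neq0 2 nb0)).
  by move/eqP; rewrite eqrXn2 // => /eqP.
apply/funext => x; pose l := hdot x b / `|b| ^+ 2.
rewrite -[x in LHS](subrK (l *: b)) SD S0; last first.
  by rewrite hdotBl hdotZl hdot_norm divfK ?expf_neq0 // subrr.
rewrite add0r SZ Sb cb -[RHS]/(`|b|^-1 *: (hdot x b *: b)) !scalerA.
by congr (_ *: _); rewrite /l; field.
Qed.

(** The square of [rank_one b] is again of this form, for [b] scaled by its norm, so
    [op_sqrt_rank_one] applies. *)
Lemma op_abs_rank_one b : b != 0 -> op_abs (rank_one b) = rank_one b.
Proof.
move=> b0; have nb0 : `|b| != 0 by rewrite normr_eq0.
have E : `|b| ^+ 2 *: rank_one b = rank_one (`|b| *: b).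
  by rewrite scale_rank_one ?exprn_ge0 // sqrCK.
rewrite /op_abs adjoint_rank_one rank_one_comp E.
rewrite op_sqrt_rank_one ?scaler_eq0 ?negb_or ?nb0 // -E normrZ normr_id.
by rewrite scalerA -expr2 mulVf ?expf_neq0 // scale1r.
Qed.

End RankOne.

(** * Bessel's inequality, Parseval's identity and traces *)

Section Trace.
Context {R : realType} {H : hilbertType R}.
Implicit Types (x y z b : H) (E : set H) (T : H -> H).
Local Open Scope classical_set_scope.

Lemma diag_sum_cvgP T E (t : R[i]) : diag_sum_cvg T E t <->
  forall e : R[i], 0 < e -> exists A0 : {fset E}, forall A : {fset E},
    (A0 `<=` A)%fset -> `|t - \sum_(i : A) hdot (T (\val (\val i))) (\val (\val i))| < e.
Proof.
have FF := @summability.totally_filter E.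
split=> [/(@cvgrPdist_lt _ _ _ _ _) cvt e e0|cvt].
  by have [A0 _ A0t] := cvt _ e0; exists A0 => A /A0t.
apply/(@cvgrPdist_lt _ _ _ _ _) => e e0; have [A0 A0t] := cvt _ e0.
by exists A0 => // A /A0t.
Qed.

Lemma diag_sum_cvg_unique T E (t t' : R[i]) :
  diag_sum_cvg T E t -> diag_sum_cvg T E t' -> t = t'.
Proof.
have FF := @summability.totally_filter E.
move=> h h'; exact: (@cvg_unique _ (@norm_hausdorff _ R[i]^o) _ _ _ _ h h').
Qed.

(** Since [d] is orthogonal to [s], its squared norm is [hdot d b]. Keeping [d] as a variable with
    an equation allows expanding a single occurrence. *)
Lemma bessel_defect (s : seq H) b : uniq s ->
  (forall x y, x \in s -> y \in s -> hdot x y = (x == y)%:R) ->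
  forall d, d = b - \sum_(e <- s) hdot b e *: e ->
  (forall e, e \in s -> hdot d e = 0) /\
  `|d| ^+ 2 = `|b| ^+ 2 - \sum_(e <- s) `|hdot b e| ^+ 2.
Proof.
move=> us os d dE.
have ds e : e \in s -> hdot d e = 0.
  move=> es; rewrite dE hdotBl hdot_suml (bigD1_seq e) //=.
  rewrite big_seq_cond big1 ?addr0 => [|i /andP[si ie]]; last first.
    by rewrite hdotZl (os i e) // (negPf ie) mulr0.
  by rewrite hdotZl (os e e) // eqxx mulr1 subrr.
split=> //; rewrite -hdot_norm {2}dE hdotBr hdot_sumr big_seq_cond big1 ?subr0.
  rewrite dE hdotBl hdot_norm hdot_suml; congr (_ - _).
  by apply: eq_bigr => e _; rewrite hdotZl hdotM_conj.
by move=> e /andP[/ds es _]; rewrite hdotZr es mulr0.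
Qed.

Lemma bessel (s : seq H) b : uniq s ->
  (forall x y, x \in s -> y \in s -> hdot x y = (x == y)%:R) ->
  \sum_(e <- s) `|hdot b e| ^+ 2 <= `|b| ^+ 2.
Proof.
move=> us os; have [_ E] := bessel_defect s b us os _ erefl.
by rewrite -subr_ge0 -E exprn_ge0.
Qed.

(** Parseval's identity: [b] is a limit of vectors spanned by finite subsets of [E], and the Bessel
    defect of a finite set is at most the squared distance from [b] to its span. *)
Lemma diag_sum_rank_one b E : orthonormal_basis E ->
  diag_sum_cvg (rank_one b) E (`|b| ^+ 2).
Proof.
move=> [oE cE]; apply/diag_sum_cvgP => eps eps0.
(* The span of [E], described by duality: [v] is orthogonal to everything that is orthogonal to some
   finite [A]. *)
pose V := [set v : H | exists A : {fset E}, forall x,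
  (forall e : E, e \in A -> hdot x (\val e) = 0) -> hdot x v = 0].
have sV : linear_subspace V.
  split=> [|a u v [A Au] [B Bv]]; first by exists fset0 => x _; rewrite hdot0r.
  exists (A `|` B)%fset => x xAB; rewrite hdotDr hdotZr Au ?Bv ?mulr0 ?addr0 //.
    by move=> e eB; apply: xAB; rewrite in_fsetU eB orbT.
  by move=> e eA; apply: xAB; rewrite in_fsetU eA.
have [p Vp bpV] := orthogonal_decomposition V b sV.
have bp : b = p.
  apply/subr0_eq/cE => e Ee; apply: bpV.
  exists [fset (SigSub (mem_set Ee) : E)]%fset => x xe; exact: (xe _ (fset11 _)).
have se0 : 0 < sqrtC eps by rewrite sqrtC_gt0.
have [v [A0 vA0] bv] := closure_norm _ _ Vp _ se0; rewrite -bp in bv.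
exists A0 => A A0A.
pose s := [seq (\val e : H) | e <- enum_fset A].
have us : uniq s by rewrite map_inj_uniq ?fset_uniq //; exact: val_inj.
have sE x : x \in s -> E x.
  by move=> /mapP[e _ ->]; apply: set_mem; exact: (valP e).
have os x y : x \in s -> y \in s -> hdot x y = (x == y)%:R.
  by move=> /sE Ex /sE Ey; apply: oE.
have [] := bessel_defect s b us os _ erefl.
set d := b - _ => ds dn.
have -> : \sum_(i : A) hdot (rank_one b (\val (\val i))) (\val (\val i))
    = \sum_(e <- s) `|hdot b e| ^+ 2.
  rewrite big_map -(big_seq_fsetE _ A predT (fun e : E => hdot (rank_one b (\val e)) (\val e))).
  by apply: eq_bigr => e _; rewrite /rank_one hdotZl mulrC hdotM_conj.
rewrite -dn ger0_norm ?exprn_ge0 // -[eps]sqrtCK ltr_pXn2r // ?nnegrE ?(ltW se0) //.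
apply: le_lt_trans bv.
have [->|d0] := eqVneq d 0; first by rewrite normr0.
(* [d] is orthogonal to [A], which contains [A0], hence also to [v]. *)
have dd : hdot d d = hdot d (b - v).
  rewrite {2}/d !hdotBr hdot_sumr big_seq big1 ?subr0 => [|e es].
    rewrite (vA0 d) ?subr0 // => e eA; apply: ds; apply/mapP; exists e => //.
    by have /fsubsetP := A0A; apply.
  by rewrite hdotZr ds // mulr0.
have : `|d| ^+ 2 <= `|d| * `|b - v|.
  rewrite -hdot_norm dd -[hdot _ _]ger0_norm ?cauchy_schwarz //.
  by rewrite -dd hdot_norm exprn_ge0.
by rewrite expr2 ler_pM2l // normr_gt0.
Qed.

(** The operator is its own absolute value, and Bessel's inequality bounds the finite diagonal
    sums. *)
Lemma trace_class_rank_one b : b != 0 -> trace_class (rank_one b).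
Proof.
move=> b0; split; first exact: bounded_rank_one.
move=> E [oE _]; rewrite op_abs_rank_one //.
have [r r0 br] := hnorm_real_ex b.
apply: (@le_lt_trans _ _ (r ^+ 2)%:E); last exact: ltry.
apply: ub_ereal_sup => _ [A [fA AE] <-].
rewrite fsbig_finite //= sumEFin lee_fin -lecR rmorphXn /= -br.
rewrite rmorph_sum /=.
have -> : \sum_(i <- fset_set A) (complex.Re (hdot (rank_one b i) i))%:C%C
   = \sum_(e <- fset_set A) `|hdot b e| ^+ 2.
  by apply: eq_bigr => e _; rewrite hdotZl mulrC hdotM_conj RRe_real.

apply: bessel => [|x y]; first exact: fset_uniq.
by rewrite !in_fset_set // !inE => /AE Ex /AE Ey; apply: oE.
Qed.

(** The existence of an orthonormal basis makes the value unique. *)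
Lemma Tr_rank_one b : b != 0 -> Tr (rank_one b) = `|b| ^+ 2.
Proof.
move=> b0; apply: xget_unique.
  by split=> [|E bE]; [exact: trace_class_rank_one|exact: diag_sum_rank_one].
move=> t [_ tE]; have [E bE] := @exists_orthonormal_basis R H.
exact: diag_sum_cvg_unique (tE _ bE) (diag_sum_rank_one _ _ bE).
Qed.

(** In a basis adapted to the range, the diagonal sums count the elements of [E1]; trace 1 leaves
    exactly one such element [a]. *)
Lemma idempotent_trace1 (q : H -> H) : bounded_operator q -> q \o q = q ->
  Tr q = 1 -> exists a, [/\ hdot a a = 1, q a = a & forall x, q x = hdot (q x) a *: a].
Proof.
move=> bq qq q1; have qD := bounded_operatorD q bq.
have qZ := bounded_operatorZ q bq.
have qqx x : q (q x) = q x by rewrite -[LHS]/((q \o q) x) qq.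
have qB x y : q (x - y) = q x - q y by rewrite qD -scaleN1r qZ scaleN1r.
have q0 : q 0 = 0 by rewrite -(scale0r 0) qZ !scale0r.
pose V := [set x | q x = x].
have sV : linear_subspace V.
  by split=> [//|a u v Vu Vv]; rewrite /V /= qD qZ Vu Vv.
have cV : closure V `<=` V.
  move=> p Vp; apply/subr0_eq/eqP; rewrite -normr_le0; have [M qM] := bq.2.
  apply: (closure_bound_le0 _ _ _ (M + 1) Vp) => v Vv.
  have -> : q p - p = q (p - v) - (p - v) by rewrite qB Vv opprB addrA subrK.
  by rewrite (le_trans (ler_normB _ _)) // rmorphD mulrDl mul1r lerD2r.
have [E1 [E2 [E1V E2V bE maxE1]]] := exists_adapted_orthonormal_basis V sV cV.
(* The default value of [Tr] is 0, so [Tr q = 1] is a genuine trace. *)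
have q_diag : diag_sum_cvg q (E1 `|` E2) 1.
  pose P := [set t | trace_class q /\
    forall E, orthonormal_basis E -> diag_sum_cvg q E t].
  have [t Pt] : exists t, P t.
    apply: contrapT => /forallNP nP; move: q1; rewrite /Tr xgetPN //.
    by move/eqP; rewrite eq_sym oner_eq0.
  have : P (Tr q) by apply: xgetI Pt.
  by rewrite q1 => -[_]; apply.
have f1 e : E1 e -> hdot (q e) e = 1.
  by move=> E1e; rewrite (E1V _ E1e) bE.1 ?eqxx //; left.
have f2 e : E2 e -> hdot (q e) e = 0.
  by move=> /E2V eV; rewrite hdot_eq0C // eV // /V /= qqx.
pose f e := hdot (q e) e.
have f0 e : (E1 `|` E2) e -> 0 <= f e.
  by rewrite /f => -[/f1->|/f2->].
(* Tolerance 1 is enough: an empty [E1] gives sum 0, and two elements of [E1] give a sum of at least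
   2, both at distance at least 1 from the trace. *)
have /diag_sum_cvgP/(_ _ ltr01)[A0 A0q] := q_diag.
have sumE (A : {fset (E1 `|` E2)}) :
    \sum_(i : A) hdot (q (\val (\val i))) (\val (\val i)) = \sum_(e <- A) f (\val e).
  by rewrite -(big_seq_fsetE _ A predT (fun e : E1 `|` E2 => f (\val e))).
have fE (e : E1 `|` E2) : 0 <= f (\val e).
  by apply: f0; apply: set_mem; exact: (valP e).
have [a E1a] : exists a, E1 a.
  apply: contrapT => /forallNP nE1; have := A0q A0 (fsubset_refl _).
  rewrite sumE big1 ?subr0 ?normr1 ?ltxx // => e _.
  have : (E1 `|` E2) (\val e) by apply: set_mem; exact: (valP e).
  by case=> [/nE1//|/f2].
have E1_unique e : E1 e -> e = a.
  move=> E1e; apply: contrapT => /eqP ea.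
  pose a' : E1 `|` E2 := SigSub (mem_set (or_introl E1a)).
  pose e' : E1 `|` E2 := SigSub (mem_set (or_introl E1e)).
  pose A := (a' |` (e' |` A0))%fset.
  have A0A : (A0 `<=` A)%fset.
    by apply/fsubsetP => i iA; rewrite !in_fsetU iA !orbT.
  have := A0q A A0A; rewrite sumE.
  rewrite (big_fsetD1 a') /=; last by rewrite in_fsetU in_fset1 eqxx.
  rewrite (big_fsetD1 e') /=; last first.
    by rewrite in_fsetD1 !in_fsetU !in_fset1 eqxx orbT andbT.
  rewrite /f f1 // f1 //; set S := \sum_(_ <- _) _.
  have S0 : 0 <= S by apply: sumr_ge0 => i _; exact: fE.
  rewrite opprD addNKr normrN ger0_norm ?addr_ge0 //.
  by rewrite gtrDl => /(le_lt_trans S0); rewrite ltxx.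
have aa : hdot a a = 1 by rewrite bE.1 ?eqxx //; left.
exists a; split=> // [|x]; first exact: E1V.
(* The difference lies in [V] and is orthogonal to [a], the only element of [E1]. *)
apply/subr0_eq/maxE1; first by rewrite /V /= qB qZ qqx (E1V _ E1a).
by move=> e /E1_unique ->; rewrite hdotBl hdotZl aa mulr1 subrr.
Qed.

End Trace.

(** * Square root and trace of [adjoint q \o q] for a rank-one projection *)

Theorem mainTheorem2 (R : realType) (H : hilbertType R) (q : H -> H)
  (q_bounded : bounded_operator q) (q_idem : q \o q = q) (q_trace : Tr q = 1) :
  op_sqrt (adjoint q \o q)
    = (sqrtC (Tr (adjoint q \o q)))^-1 *: (adjoint q \o q) /\
  Tr (op_sqrt (adjoint q \o q)) = sqrtC (Tr (adjoint q \o q)).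
Proof.
have [a [aa qaa qa]] := idempotent_trace1 q q_bounded q_idem q_trace.
have a1 : `|a| = 1.
  by apply/eqP; rewrite -(sqrp_eq1 (normr_ge0 a)) -hdot_norm aa.
have [M qM] := q_bounded.2.
have [b qb] : exists b, forall x, hdot (q x) a = hdot x b.
  apply: (riesz (fun x => hdot (q x) a) M) => [c x y|x].
    by rewrite (bounded_operatorD q q_bounded) (bounded_operatorZ q q_bounded) hdotDl hdotZl.
  by apply: (le_trans (cauchy_schwarz _ _)); rewrite a1 mulr1; exact: qM.
have {qb}qE x : q x = hdot x b *: a by rewrite qa qb.
have qadj y : adjoint q y = hdot y a *: b.
  rewrite (@adjoint_eq _ _ q (fun y => hdot y a *: b)) //; last first.
    by move=> x z; rewrite qE hdotZl hdotZr -hdotC mulrC.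
  split=> [c x z|]; first by rewrite hdotDl hdotZl scalerDl scalerA.
  have [r r0 br] := hnorm_real_ex b; exists r => x.
  rewrite normrZ mulrC br ler_wpM2l ?lecR //.
  by rewrite (le_trans (cauchy_schwarz _ _)) // a1 mulr1.
have qqE : adjoint q \o q = rank_one b.
  by apply/funext => x; rewrite /= qadj qE hdotZl aa mulr1.
(* Otherwise [q] would vanish, against [q a = a] with [a] a unit vector. *)
have b0 : b != 0.
  apply/eqP => b0; move: aa; rewrite -qaa qE b0 hdot0r scale0r hdot0l.
  by move/eqP; rewrite eq_sym oner_eq0.
have nb0 : `|b| != 0 by rewrite normr_eq0.
rewrite qqE Tr_rank_one // sqrCK // op_sqrt_rank_one //; split=> //.
(* The square root is [rank_one] of [b] divided by the square root of its norm, a vector whose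
   squared norm is the norm of [b]. *)
rewrite scale_rank_one ?invr_ge0 // Tr_rank_one; last first.
  by rewrite scaler_eq0 negb_or sqrtC_eq0 invr_eq0 nb0.
rewrite normrZ exprMn ger0_norm ?sqrtC_ge0 ?invr_ge0 // sqrtCK.
by rewrite expr2 mulKf.
Qed.
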